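(* Let $n\ge2$. The following are equivalent for two maps $\phi_1,\phi_2:\langle\mathbf{DS}_n\rangle\to\langle\mathbf{DS}_n\rangle$: (1) $\operatorname{tr}(\phi_1(A_1)\phi_2(A_2))=\operatorname{tr}(A_1A_2)$ for all $A_1,A_2\in\langle\mathbf{DS}_n\rangle$; moreover, there is $p\in\{1,2\}$ such that for every $A\in\langle\mathbf{DS}_n\rangle$, $\operatorname{rank}(A)\le1$ implies $\operatorname{rank}(\phi_p(A))\le1$. (2) $\operatorname{spec}(\phi_1(A_1)\phi_2(A_2))=\operatorname{spec}(A_1A_2)$ for all $A_1,A_2\in\langle\mathbf{DS}_n\rangle$. (3) One of the following statements holds: (a) $n=2$, and there are an invertible $C\in\langle\mathbf{DS}_2\rangle$ and $P\in\left\{I_2,\begin{pmatrix}1&0\\0&-1\end{pmatrix}\right\}$ such that $\phi_1(A)=CPAP^{-1}$ and $\phi_2(A)=PAP^{-1}C^{-1}$ for all $A\in\langle\mathbf{DS}_2\rangle$. (b) $n\ge3$, and there exist invertible matrices $P,Q\in\langle\mathbf{DS}_n\rangle$ such that either $\phi_1(A)=PAQ^{-1}$ and $\phi_2(A)=QAP^{-1}$ for all $A\in\langle\mathbf{DS}_n\rangle$, or $\phi_1(A)=PA^tQ^{-1}$ and $\phi_2(A)=QA^tP^{-1}$ for all $A\in\langle\mathbf{DS}_n\rangle$.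
   Context: $\mathbf{DS}_n$ is the set of $n\times n$ doubly stochastic matrices (real, entrywise nonnegative, all row sums and all column sums equal to $1$). $\langle\mathbf{DS}_n\rangle$ is its real linear span; with $e=(1,\ldots,1)^t\in\mathbb{R}^n$, it equals $\{A\in M_n(\mathbb{R}): Ae=ce,\ e^tA=ce^t \text{ for some } c\in\mathbb{R}\}$. $A^t$ is the transpose of $A$. $\operatorname{spec}(A)$ is the spectrum (multiset of complex eigenvalues) of $A$ counting multiplicities. The maps $\phi_1,\phi_2$ are not assumed linear. *)

(* Defs.v *)
From HB Require Import structures.
From mathcomp Require Import all_boot all_order all_algebra.
From mathcomp Require Import finmap multiset.
From mathcomp Require Import complex.
From mathcomp Require Import classical_sets reals.

Set Implicit Arguments.
Unset Strict Implicit.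
Unset Printing Implicit Defensive.

Local Open Scope mset_scope.
Local Open Scope classical_set_scope.
Local Open Scope ring_scope.

Definition DS (R : realType) (n : nat) : set 'M[R]_n :=
  [set A | [/\ forall i j, 0 <= A i j,
               forall i, \sum_j A i j = 1
             & forall j, \sum_i A i j = 1]].

Definition linear_span (R : realType) (V : lmodType R) (S : set V) : set V :=
  [set v | exists k (c : 'I_k -> R) (s : 'I_k -> V),
             (forall i, S (s i)) /\ v = \sum_i c i *: s i].

Definition spanDS (R : realType) (n : nat) : set 'M[R]_n :=
  linear_span (@DS R n).

(* [closed_field_poly_normal p] provides a sequence listing the roots of [p]
   with multiplicity; any two such sequences give the same multiset. *)
Definition spec (R : realType) (n : nat) (A : 'M[R]_n) : {mset R[i]} :=
  seq_mset (sval (closed_field_poly_normal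
    (char_poly (map_mx (real_complex R) A)))).

Arguments DS : clear implicits.
Arguments spanDS : clear implicits.

(* Main.v *)
Require Import Defs.
From HB Require Import structures.
From mathcomp Require Import all_boot all_order all_algebra.
From mathcomp Require Import finmap multiset.
From mathcomp Require Import complex.
From mathcomp Require Import classical_sets reals.
From mathcomp Require Import boolp ring lra.

Set Implicit Arguments.
Unset Strict Implicit.
Unset Printing Implicit Defensive.

Import Order.TTheory GRing.Theory Num.Theory.

Local Open Scope ring_scope.

(** A matrix lies in the span of DS_n exactly when the all-ones vector e is
    both a right and a left eigenvector for one common eigenvalue.  A symmetric
    involution H (a Householder reflection) carrying e to a multiple of the
    first basis vector therefore turns the span into the block diagonal algebra
    of pairs (c, B), with c of size 1 and B of size m = n - 1; because H is
    symmetric, this change of coordinates respects transposition as well as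
    products, traces and ranks.  Everything is decided on such pairs.

    Trace condition.  The form (x, y) |-> tr (x_1 y_1) + tr (x_2 y_2) is
    nondegenerate.  If f x . g y = x . y for two arbitrary maps of F^N, the
    matrices K, L of the images of the canonical basis satisfy K L^T = 1, which
    forces f x = x K and g y = y (K^-1)^T ([dot_preserving_linear]).  So phi1
    and phi2 are linear bijections, and each determines the other.

    Rank condition.  A pair has rank at most 1 if it is (c, 0), or (0, B) with
    B of rank at most 1.  When m >= 2, the space of all x y^T with x fixed has
    dimension m and consists of matrices of rank at most 1, so no element of its
    image can have a nonzero scalar component; hence the map preserves the
    summand of all (0, B), acts there as B |-> U B V or B |-> U B^T V by the classical theorem
    on rank-one preservers ([rank_one_preserver]), and multiplies the other
    summand by a nonzero d.  With P and Q the matrices of the pairs (d, U) and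
    (1, V^-1) this is the form claimed for n >= 3 ([standard_form_block]).
    When m = 1 the two coordinate axes are either kept or exchanged, and the
    exchange is conjugation by diag(1, -1) ([standard_form_two]).

    Spectra.  The standard forms preserve characteristic polynomials, as those
    of A B, B A and of a transpose agree.  Conversely equal spectra have equal
    traces, so only the rank condition has to be recovered ([spec_rank]): if A
    has rank at most 1, a nonzero eigenvalue of A B can only be tr (A B).  By
    surjectivity of phi2, B may be chosen so that phi1 A phi2 B is an
    idempotent of the same rank r as phi1 A; if r > 0 then 1 is an eigenvalue,
    so r = tr (A B) = 1. *)

(** * Characteristic polynomials of products *)

(** Both sides appear, up to the nonzero factor 'X ^+ n, as the determinant of
    the block matrix with rows ('X, A) and (B, 1): clear its upper right or its
    lower left block. *)
Lemma char_poly_mulC (F : idomainType) (n : nat) (A B : 'M[F]_n) :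
  char_poly (A *m B) = char_poly (B *m A).
Proof.
rewrite /char_poly /char_poly_mx !map_mxM /=.
set a := map_mx _ A; set b := map_mx _ B.
pose M := block_mx 'X%:M a b 1%:M.
have MAB : \det M = \det ('X%:M - a *m b).
  have E : block_mx 1%:M (- a) 0 1%:M *m M = block_mx ('X%:M - a *m b) 0 b 1%:M.
    by rewrite mulmx_block !mul1mx !mul0mx !mulNmx mulmx1 !add0r subrr.
  have := congr1 determinant E.
  by rewrite det_mulmx det_ublock det_lblock !det1 !mul1r mulr1.
have MBA : 'X ^+ n * \det M = 'X ^+ n * \det ('X%:M - b *m a).
  have E : block_mx 1%:M 0 (- b) 'X%:M *m M =
      block_mx 'X%:M a 0 ('X%:M - b *m a).
    rewrite mulmx_block !mul1mx !mul0mx !mulNmx !addr0 mulmx1.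
    by rewrite mul_mx_scalar mul_scalar_mx addNr addrC.
  have := congr1 determinant E.
  by rewrite det_mulmx det_lblock det_ublock det1 mul1r det_scalar.
by rewrite -MAB; apply: (mulfI _ MBA); rewrite expf_neq0 ?polyX_eq0.
Qed.

Lemma char_poly_conj (F : fieldType) (n : nat) (P A : 'M[F]_n) :
  P \in unitmx -> char_poly (P *m A *m invmx P) = char_poly A.
Proof. by move=> uP; rewrite char_poly_mulC mulmxA mulVmx // mul1mx. Qed.

(** * Matrices of rank at most one *)

Section RankOne.

Variable F : fieldType.

Lemma rank_le1P m n (A : 'M[F]_(m, n)) :
  reflect (exists (u : 'cV_m) (v : 'rV_n), A = u *m v) (\rank A <= 1)%N.
Proof.
apply: (iffP idP) => [|[u [v ->]]]; last first.
  exact: leq_trans (mxrankM_maxl _ _) (rank_leq_col _).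
rewrite leq_eqVlt ltnS leqn0 mxrank_eq0 => /predU1P[r1|/eqP->]; last first.
  by exists 0, 0; rewrite mul0mx.
have := mulmx_base A; move: (col_base A) (row_base A); rewrite r1 => u v <-.
by exists u, v.
Qed.

(** The 2 x 2 minors of the sum factor as products of a minor of the columns
    (u, w) and a minor of the rows (v, z). *)
Lemma outer_addP m n (u w : 'cV[F]_m) (v z : 'rV[F]_n) :
  u != 0 -> v != 0 -> (\rank (u *m v + w *m z)%R <= 1)%N ->
  (exists a, z = a *: v) \/ (exists a, w = a *: u).
Proof.
move=> /cV0Pn[i ui] /rV0Pn[j vj] /rank_le1P[p [q E]].
have minor k l : (u i 0 * w k 0 - u k 0 * w i 0) *
                 (v 0 j * z 0 l - v 0 l * z 0 j) = 0.
  have e s t : u s 0 * v 0 t + w s 0 * z 0 t = p s 0 * q 0 t.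
    by have /matrixP/(_ s t) := E; rewrite !mxE !big_ord1.
  transitivity ((u i 0 * v 0 j + w i 0 * z 0 j) *
                (u k 0 * v 0 l + w k 0 * z 0 l) -
                (u i 0 * v 0 l + w i 0 * z 0 l) *
                (u k 0 * v 0 j + w k 0 * z 0 j)); first by ring.
  by rewrite !e; ring.
have [zv|/forallPn[l zl]] := boolP [forall l, v 0 j * z 0 l == v 0 l * z 0 j].
  left; exists (z 0 j / v 0 j); apply/rowP => l; rewrite mxE.
  apply: (mulfI vj); rewrite (eqP (forallP zv l)).
  by field.
right; exists (w i 0 / u i 0); apply/colP => k; rewrite mxE.
have /eqP := minor k l; rewrite mulf_eq0 !subr_eq0 (negPf zl) orbF => /eqP e.
by apply: (mulfI ui); rewrite e; field.
Qed.

(** Two outer products whose sum has rank at most 1 share their column or their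
    row, up to scaling.  If some value f y1 leaves the column of f y0 = a *m b,
    it keeps the row b, and then every further value, compared with both f y0
    and f y1, has to keep b. *)
Lemma rank_le1_family (V : nmodType) m n (f : V -> 'M[F]_(m, n)) :
  {morph f : x y / x + y} -> (forall y, (\rank (f y) <= 1)%N) ->
  (exists u : 'cV_m, forall y, exists v : 'rV_n, f y = u *m v) \/
  (exists v : 'rV_n, forall y, exists u : 'cV_m, f y = u *m v).
Proof.
move=> fD f1.
have [[y0 fy0]|/forallNP f0] := EM (exists y, f y != 0); last first.
  left; exists 0 => y; exists 0; rewrite mulmx0.
  by apply/eqP/negPn/negP/f0.
have /rank_le1P[a [b eab]] := f1 y0.
have a0 : a != 0 by apply: contraNneq fy0 => a0; rewrite eab a0 mul0mx.
have b0 : b != 0 by apply: contraNneq fy0 => b0; rewrite eab b0 mulmx0.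
have near_y0 y u v : f y = u *m v ->
    (exists k, v = k *: b) \/ (exists k, u = k *: a).
  move=> e; apply: (outer_addP a0 b0).
  by rewrite -eab -e -fD.
have [|/existsNP[y1 ny1]] := EM (forall y, exists v : 'rV_n, f y = a *m v).
  by left; exists a.
right; exists b => y.
have /rank_le1P[c [d ecd]] := f1 y1.
have [[k dk]|[k ck]] := near_y0 _ _ _ ecd; last first.
  by case: ny1; exists (k *: d); rewrite ecd ck -scalemxAl scalemxAr.
have {}ecd : f y1 = (k *: c) *m b by rewrite ecd dk -scalemxAl scalemxAr.
move: (k *: c) ecd => {d k dk}c ecd.
have c0 : c != 0.
  by apply: contra_notN ny1 => /eqP c0; exists 0; rewrite ecd c0 mul0mx mulmx0.
have /rank_le1P[e [g eeg]] := f1 y.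
have [[k gk]|[k ek]] := near_y0 _ _ _ eeg.
  by exists (k *: e); rewrite eeg gk -scalemxAl scalemxAr.
have [|[l gl]|[l el]] := @outer_addP _ _ c e b g c0 b0.
- by rewrite -ecd -eeg -fD.
- by exists (l *: e); rewrite eeg gl -scalemxAl scalemxAr.
have [k0|k0] := eqVneq k 0.
  by exists 0; rewrite eeg ek k0 scale0r !mul0mx.
have [l0|l0] := eqVneq l 0.
  by exists 0; rewrite eeg el l0 scale0r !mul0mx.
case: ny1; exists ((k / l) *: b).
rewrite ecd -scalemxAr scalemxAl; congr (_ *m _).
by apply: (scalerI l0); rewrite -el ek scalerA mulrCA divff // mulr1.
Qed.

Lemma linv_cV m (u : 'cV[F]_m) : u != 0 -> exists l : 'rV_m, l *m u = 1%:M.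
Proof.
move=> u0; exists (pinvmx u); apply: mulVpmx.
by rewrite /row_full eqn_leq rank_leq_col lt0n mxrank_eq0.
Qed.

Lemma rinv_rV m (v : 'rV[F]_m) : v != 0 -> exists r : 'cV_m, v *m r = 1%:M.
Proof.
move=> v0; exists (pinvmx v); apply: mulmxVp.
by rewrite /row_free eqn_leq rank_leq_row lt0n mxrank_eq0.
Qed.

Lemma outer_eq0 m n (u : 'cV[F]_m) (v : 'rV[F]_n) :
  (u *m v == 0) = (u == 0) || (v == 0).
Proof.
apply/idP/orP => [/eqP uv|[]/eqP->]; rewrite ?mul0mx ?mulmx0 //.
have [|u0] := eqVneq u 0; first by left.
right; have [l lu] := linv_cV u0.
by rewrite -[v]mul1mx -lu -mulmxA uv mulmx0.
Qed.

(** Comparing the eigenvalue of a sum of two basis vectors with theirs shows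
    that all eigenvalues agree. *)
Lemma scalar_of_eigen_all m (K : 'M[F]_m) :
  (forall y : 'rV_m, exists k, y *m K = k *: y) -> exists k, K = k%:M.
Proof.
case: m K => [|m] K hK; first by exists 0; apply/matrixP => -[].
have [k hk] := hK (delta_mx 0 0).
exists k; apply/row_matrixP => i; rewrite !rowE.
have [->|i0] := eqVneq i 0; first by rewrite hk mul_mx_scalar.
have [a ha] := hK (delta_mx 0 i).
have [b hb] := hK (delta_mx 0 0 + delta_mx 0 i).
move: hb; rewrite mulmxDl hk ha scalerDr => hb.
have := congr1 (fun M : 'rV_m.+1 => M 0 0) hb.
have := congr1 (fun M : 'rV_m.+1 => M 0 i) hb.
rewrite !mxE !eqxx (negPf i0) eq_sym (negPf i0) /= !mulr1 !mulr0 !add0r !addr0.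
by move=> -> ->; rewrite mul_mx_scalar.
Qed.

(** * Linear rank-one preservers *)

Section Preserver.

Variables (m : nat) (T : {linear 'M[F]_m -> 'M[F]_m}).
Hypothesis T_inj : forall B, T B = 0 -> B = 0.
Hypothesis T_rank : forall B, (\rank B <= 1)%N -> (\rank (T B) <= 1)%N.

Let rT (x : 'cV_m) (y : 'rV_m) : (\rank (T (x *m y)) <= 1)%N.
Proof. by apply: T_rank; apply/rank_le1P; exists x, y. Qed.

Let T_neq0 (x : 'cV_m) (y : 'rV_m) : x != 0 -> y != 0 -> T (x *m y) != 0.
Proof.
move=> x0 y0; apply: contraNneq (_ : x *m y != 0) => [/T_inj->//|].
by rewrite outer_eq0 negb_or x0.
Qed.

Definition same_column (x : 'cV_m) :=
  exists u : 'cV_m, forall y, exists v : 'rV_m, T (x *m y) = u *m v.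
Definition same_row (x : 'cV_m) :=
  exists v : 'rV_m, forall y, exists u : 'cV_m, T (x *m y) = u *m v.

Lemma column_or_row x : same_column x \/ same_row x.
Proof.
by apply: (rank_le1_family (f := fun y => T (x *m y))) => // y z;
  rewrite mulmxDr linearD.
Qed.

(** If x failed the first alternative and x' the second, then
    T (x *m y) = h y *m b and T (x' *m y) = a *m g y, and the rank of
    T ((x + x') *m y) forces, for each y, g y parallel to b or h y parallel to
    a.  Both conditions cut out proper subspaces of the y, and two proper
    subspaces do not cover the whole space. *)
Lemma all_column_or_all_row :
  (forall x, same_column x) \/ (forall x, same_row x).
Proof.
apply: contrapT => /not_orP[/existsNP[x ncx] /existsNP[x' nrx]].
have [//|[b hb]] := column_or_row x.
have [[a ha]|//] := column_or_row x'.
have x0 : x != 0.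
  apply: contra_notN ncx => /eqP->; exists 0 => y; exists 0.
  by rewrite !mul0mx linear0.
have x'0 : x' != 0.
  apply: contra_notN nrx => /eqP->; exists 0 => y; exists 0.
  by rewrite !mul0mx linear0.
have a0 : a != 0.
  apply: contra_notN nrx => /eqP a0; exists 0 => y; exists 0.
  by have [v ->] := ha y; rewrite a0 !mul0mx.
have b0 : b != 0.
  apply: contra_notN ncx => /eqP b0; exists 0 => y; exists 0.
  by have [v ->] := hb y; rewrite b0 !mulmx0.
have [l la] := linv_cV a0; have [r br] := rinv_rV b0.
pose g y := l *m T (x' *m y); pose h y := T (x *m y) *m r.
have gE y : T (x' *m y) = a *m g y.
  by have [v e] := ha y; rewrite /g e [l *m _]mulmxA la mul1mx.
have hE y : T (x *m y) = h y *m b.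
  by have [v e] := hb y; rewrite /h e -[v *m b *m r]mulmxA br mulmx1.
have gD y z : g (y + z) = g y + g z by rewrite /g mulmxDr linearD mulmxDr.
have hD y z : h (y + z) = h y + h z by rewrite /h mulmxDr linearD mulmxDl.
have dich y : (exists k, g y = k *: b) \/ (exists k, h y = k *: a).
  have [->|y0] := eqVneq y 0.
    by left; exists 0; rewrite /g mulmx0 linear0 mulmx0 scale0r.
  have g0 : g y != 0.
    by apply: contraNneq (T_neq0 x'0 y0) => g0; rewrite gE g0 mulmx0.
  have [|[k bk]|] := @outer_addP _ _ a (h y) (g y) b a0 g0.
  - by rewrite -gE -hE -linearD -mulmxDl; apply: rT.
  - left; exists k^-1; rewrite bk scalerA mulVf ?scale1r //.
    by apply: contraNneq b0 => k0; rewrite bk k0 scale0r.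
  - by right.
have /existsNP[y1 hy1] : ~ forall y, exists k, h y = k *: a.
  apply: contra_not ncx => hh; exists a => y; have [k hk] := hh y.
  by exists (k *: b); rewrite hE hk -scalemxAl scalemxAr.
have /existsNP[y2 gy2] : ~ forall y, exists k, g y = k *: b.
  apply: contra_not nrx => hh; exists b => y; have [k hk] := hh y.
  by exists (k *: a); rewrite gE hk -scalemxAr scalemxAl.
have [[k1 gk]|//] := dich y1; have [//|[k2 hk]] := dich y2.
have [[k e]|[k e]] := dich (y1 + y2).
- apply: gy2; exists (k - k1); rewrite scalerBl -gk -e gD.
  by rewrite addrAC subrr add0r.
- by apply: hy1; exists (k - k2); rewrite scalerBl -hk -e hD addrK.
Qed.

(** Fix a nonzero x0, with T (x0 *m y) = a *m (y *m G).  For x not a multiple of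
    x0, T (x *m y) = b *m (y *m H), and b is not a multiple of a since otherwise
    the images for x and x0 would coincide, against injectivity.  The rank of
    T ((x0 + x) *m y) then makes y *m H parallel to y *m G for every y, so H is
    a multiple of G.  Thus T (x *m y) = w_x *m (y *m G), and U collects the
    columns w_x of the basis vectors. *)
Lemma column_preserver : (forall x, same_column x) ->
  exists U V : 'M[F]_m, forall B, T B = U *m B *m V.
Proof.
move=> cT; case: (posnP m) => [m0|m_gt0].
  by exists 0, 0 => B; apply/matrixP => i; have := ltn_ord i; rewrite {2}m0.
pose x0 : 'cV[F]_m := delta_mx (Ordinal m_gt0) 0.
pose y0 : 'rV[F]_m := delta_mx 0 (Ordinal m_gt0).
have delta_neq0 p q i j : delta_mx i j != 0 :> 'M[F]_(p, q).
  apply/eqP => /matrixP/(_ i j)/eqP; rewrite !mxE !eqxx /=.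
  by rewrite oner_eq0.
have x0_neq0 : x0 != 0 by apply: delta_neq0.
have y0_neq0 : y0 != 0 by apply: delta_neq0.
have col_factor x : x != 0 -> exists2 a : 'cV_m, a != 0 &
    exists G : 'M_m, forall y, T (x *m y) = a *m (y *m G).
  move=> xn0; have [a ha] := cT x.
  have an0 : a != 0.
    apply: contraNneq (T_neq0 xn0 y0_neq0) => a0.
    by have [v ->] := ha y0; rewrite a0 mul0mx.
  exists a => //; have [l la] := linv_cV an0.
  exists (lin1_mx (fun y => l *m T (x *m y))) => y.
  pose gl := mulmx l \o T \o mulmx x.
  rewrite -[fun _ => _]/(gl : _ -> _) mul_rV_lin1 /gl /=.
  by have [v ->] := ha y; rewrite [l *m _]mulmxA la mul1mx.
have [a a0 [G hG]] := col_factor x0 x0_neq0.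
have GI (y : 'rV_m) : y *m G = 0 -> y = 0.
  move=> yG; apply: contraTeq isT => yn0; have := T_neq0 x0_neq0 yn0.
  by rewrite hG yG mulmx0 eqxx.
have uG : G \in unitmx.
  rewrite -row_free_unit -kermx_eq0; apply/eqP/row_matrixP => i.
  by rewrite row0; apply: GI; rewrite -row_mul mulmx_ker row0.
have wP x : exists w : 'cV_m, forall y, T (x *m y) = w *m (y *m G).
  have [[k ->]|nk] := EM (exists k, x = k *: x0).
    exists (k *: a) => y.
    by rewrite -scalemxAl linearZ /= hG scalemxAl.
  have xn0 : x != 0.
    by apply: contra_notN nk => /eqP->; exists 0; rewrite scale0r.
  have [b b0 [H hH]] := col_factor x xn0.
  have nba : ~ exists k, b = k *: a.
    case=> k bk; apply: nk.
    (* the row that x0 would need to produce the same image as x with y0 *)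
    pose y' := k *: y0 *m H *m invmx G.
    have : T (x *m y0 - x0 *m y') = 0.
      rewrite linearB /= hH hG /y' mulmxKV // bk -!scalemxAl -!scalemxAr.
      by rewrite subrr.
    move=> /T_inj/eqP; rewrite subr_eq0 => /eqP e.
    have [r yr] := rinv_rV y0_neq0.
    exists ((y' *m r) 0 0).
    rewrite -[x]mulmx1 -yr [x *m _]mulmxA e -mulmxA.
    by rewrite {1}[y' *m r]mx11_scalar mul_mx_scalar.
  have eig (y : 'rV_m) : exists k, y *m (H *m invmx G) = k *: y.
    have [->|yn0] := eqVneq y 0; first by exists 0; rewrite mul0mx scale0r.
    have yGn0 : y *m G != 0 by apply: contraNneq yn0 => /GI->.
    have [|[k yk]|//] := @outer_addP _ _ a b (y *m G) (y *m H) a0 yGn0.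
      by rewrite -hG -hH -linearD -mulmxDl; apply: rT.
    by exists k; rewrite mulmxA yk -scalemxAl mulmxK.
  have [k hk] := scalar_of_eigen_all eig.
  exists (k *: b) => y; rewrite hH.
  have -> : H = k *: G by rewrite -[H](mulmxKV uG) hk mul_scalar_mx.
  by rewrite -!scalemxAr -scalemxAl.
have y0G : y0 *m G != 0 by apply: contraNneq y0_neq0 => /GI->.
have [r Gr] := rinv_rV y0G.
pose U := \matrix_(i, j) (T (delta_mx j 0 *m y0) *m r) i 0.
exists U, G => B.
rewrite {1}[B]matrix_sum_delta {2}[B]matrix_sum_delta.
rewrite linear_sum mulmx_sumr mulmx_suml; apply: eq_bigr => i _.
rewrite linear_sum mulmx_sumr mulmx_suml; apply: eq_bigr => j _.
rewrite linearZ /= -scalemxAr -scalemxAl; congr (_ *: _).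
rewrite -(mul_delta_mx (0 : 'I_1)) [U *m _]mulmxA -colE.
have [w hw] := wP (delta_mx i 0); rewrite hw -mulmxA; congr (_ *m _).
by apply/colP => k; rewrite [RHS]mxE [RHS]mxE hw -mulmxA Gr mulmx1.
Qed.

End Preserver.

Lemma unitmx_of_ker0 m (U : 'M[F]_m) :
  (forall B : 'M_m, B *m U = 0 -> B = 0) -> U \in unitmx.
Proof.
by move=> U0; rewrite -row_free_unit -kermx_eq0; apply/eqP/U0/mulmx_ker.
Qed.

(** [column_preserver] applies to T itself or to its composite with
    transposition; U and V are invertible because T has trivial kernel. *)
Theorem rank_one_preserver m (T : {linear 'M[F]_m -> 'M[F]_m}) :
  (forall B, T B = 0 -> B = 0) ->
  (forall B, (\rank B <= 1)%N -> (\rank (T B) <= 1)%N) ->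
  exists U V : 'M[F]_m, [/\ U \in unitmx, V \in unitmx &
    (forall B, T B = U *m B *m V) \/ (forall B, T B = U *m B^T *m V)].
Proof.
move=> T_inj T_rank.
have units (U V : 'M[F]_m) (t : 'M[F]_m -> 'M[F]_m) : cancel t t ->
    t 0 = 0 -> (forall B, T (t B) = U *m B *m V) ->
    U \in unitmx /\ V \in unitmx.
  move=> tK t0 TE; split.
    rewrite -unitmx_tr; apply: unitmx_of_ker0 => B BU.
    suff : B^T = 0 by move=> /(congr1 trmx); rewrite trmxK trmx0.
    have : T (t B^T) = 0 by rewrite TE -[U]trmxK -trmx_mul BU trmx0 mul0mx.
    by move=> /T_inj/(congr1 t); rewrite tK t0.
  apply: unitmx_of_ker0 => B BV.
  have : T (t B) = 0 by rewrite TE -mulmxA BV mulmx0.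
  by move=> /T_inj/(congr1 t); rewrite tK t0.
have [cT|rT] := all_column_or_all_row T_inj T_rank.
  have [U [V TE]] := column_preserver T_inj T_rank cT.
  have [uU uV] := units U V id (fun=> erefl) erefl TE.
  by exists U, V; split; auto.
pose T' : {linear 'M[F]_m -> 'M[F]_m} := trmx \o T.
have [||x|U [V T'E]] := @column_preserver _ T'.
- by move=> B /(congr1 trmx); rewrite /= trmxK trmx0 => /T_inj.
- by move=> B rB; rewrite /= mxrank_tr T_rank.
- have [v hv] := rT x; exists v^T => y; have [u hu] := hv y.
  by exists u^T; rewrite /= hu trmx_mul.
have TE B : T B^T = V^T *m B *m U^T.
  by rewrite -[T _]trmxK -[(T _)^T]/(T' _) T'E !trmx_mul trmxK mulmxA.
exists V^T, U^T.
have [uV uU] := units V^T U^T trmx (@trmxK _ _ _) (trmx0 _ _ _) TE.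
by split=> //; right=> B; rewrite -{1}[B]trmxK TE.
Qed.

End RankOne.

(** * Maps adjoint for the trace form *)

Section Adjoint.

Variable F : fieldType.

(** No linearity is assumed: if K and L have the rows f e_i and g e_i, the
    hypothesis for basis vectors reads f x *m L^T = x and K *m (g y)^T = y^T,
    and in particular K *m L^T = 1. *)
Lemma dot_preserving_linear N (f g : 'rV[F]_N -> 'rV[F]_N) :
  (forall x y, f x *m (g y)^T = x *m y^T) ->
  exists2 K : 'M_N, K \in unitmx &
    (forall x, f x = x *m K) /\ (forall y, g y = y *m (invmx K)^T).
Proof.
move=> fg.
pose K := \matrix_i f (delta_mx 0 i); pose L := \matrix_i g (delta_mx 0 i).
have fL x : f x *m L^T = x.
  apply/rowP => j; have /matrixP/(_ 0 0) := fg x (delta_mx 0 j).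
  rewrite trmx_delta -colE mxE [RHS]mxE => <-; rewrite mxE.
  by apply: eq_bigr => k _; rewrite !mxE.
have KL : K *m L^T = 1%:M.
  by apply/row_matrixP => i; rewrite row_mul rowK fL row1.
have [uK _] := mulmx1_unit KL; have LK := mulmx1C KL.
exists K => //; split=> [x|y].
  by rewrite -[in RHS](fL x) -mulmxA LK mulmx1.
have Kg : K *m (g y)^T = y^T.
  by apply/row_matrixP => i; rewrite row_mul rowK fg rowE.
by apply: trmx_inj; rewrite trmx_mul trmxK -Kg mulKmx.
Qed.

Variable m : nat.

Local Notation W := ('M[F]_1 * 'M[F]_m)%type.

Definition trform (x y : W) : F := \tr (x.1 *m y.1) + \tr (x.2 *m y.2).

Definition pair_rank (w : W) : nat := (\rank w.1 + \rank w.2)%N.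

Lemma trformC x y : trform x y = trform y x.
Proof. by rewrite /trform mxtrace_mulC [\tr (x.2 *m _)]mxtrace_mulC. Qed.

(** Coordinates in which the trace form becomes the standard dot product, once
    the second argument has its block transposed by [pair_tr]. *)
Definition pair_coords (w : W) : 'rV[F]_(1 + m * m) := row_mx w.1 (mxvec w.2).
Definition pair_of_coords (r : 'rV[F]_(1 + m * m)) : W :=
  (lsubmx r, vec_mx (rsubmx r)).
Definition pair_tr (w : W) : W := (w.1, w.2^T).

Lemma pair_coordsK : cancel pair_coords pair_of_coords.
Proof. by case=> c B; rewrite /pair_of_coords row_mxKl row_mxKr mxvecK. Qed.

Lemma pair_of_coordsK : cancel pair_of_coords pair_coords.
Proof. by move=> r; rewrite /pair_coords vec_mxK hsubmxK. Qed.

Lemma pair_trK : involutive pair_tr.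
Proof. by case=> c B; rewrite /pair_tr /= trmxK. Qed.

Lemma mxvec_dot_tr (A B : 'M[F]_m) :
  mxvec A *m (mxvec B^T)^T = (\tr (A *m B))%:M.
Proof.
apply/matrixP => i j; rewrite !ord1 !mxE eqxx mulr1n.
rewrite (reindex _ (curry_mxvec_bij m m)) /=.
rewrite (eq_bigr (fun p : 'I_m * 'I_m => A p.1 p.2 * B p.2 p.1)); last first.
  by case=> k l _; rewrite [_^T _ 0]mxE /= !mxvecE mxE.
rewrite -(pair_bigA _ (fun k l => A k l * B l k)) /=.
by apply: eq_bigr => k _; rewrite mxE.
Qed.

Lemma trform_coords x y :
  pair_coords x *m (pair_coords (pair_tr y))^T = (trform x y)%:M.
Proof.
rewrite /pair_coords tr_row_mx mul_row_col mxvec_dot_tr /trform raddfD /=.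
congr (_ + _); rewrite [y.1]mx11_scalar [x.1]mx11_scalar.
by rewrite tr_scalar_mx mul_scalar_mx scale_scalar_mx mxtrace_scalar.
Qed.

Lemma trform_nondeg (y y' : W) :
  (forall x, trform x y = trform x y') -> y = y'.
Proof.
move=> yy'; apply: (can_inj pair_trK); apply: (can_inj pair_coordsK).
apply: trmx_inj; apply/row_matrixP => i.
rewrite !rowE -[delta_mx _ _]pair_of_coordsK.
by rewrite !trform_coords yy'.
Qed.

Lemma trform_preserving (psi1 psi2 : W -> W) :
  (forall x y, trform (psi1 x) (psi2 y) = trform x y) ->
  [/\ forall a x y, psi1 (a *: x + y) = a *: psi1 x + psi1 y,
      forall x, psi1 x = 0 -> x = 0 &
      forall z, exists x, psi1 x = z].
Proof.
move=> psiP.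
pose f r := pair_coords (psi1 (pair_of_coords r)).
pose g r := pair_coords (pair_tr (psi2 (pair_tr (pair_of_coords r)))).
have fg r s : f r *m (g s)^T = r *m s^T.
  rewrite trform_coords psiP -trform_coords pair_trK.
  by rewrite !pair_of_coordsK.
have [K uK [fK _]] := dot_preserving_linear fg.
have psi1E x : psi1 x = pair_of_coords (pair_coords x *m K).
  by rewrite -fK /f !pair_coordsK.
have coordsP a x y :
    pair_coords (a *: x + y) = a *: pair_coords x + pair_coords y.
  by rewrite /pair_coords /= linearP scale_row_mx add_row_mx.
have coords'P a r s :
    pair_of_coords (a *: r + s) = a *: pair_of_coords r + pair_of_coords s.
  by rewrite /pair_of_coords !linearP.
split=> [a x y|x x0|z].
- by rewrite !psi1E coordsP mulmxDl -scalemxAl coords'P.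
- have : pair_coords x *m K = 0.
    by rewrite -fK /f pair_coordsK x0 /pair_coords /= linear0 row_mx0.
  move=> /(congr1 (mulmxr (invmx K))) /=; rewrite mulmxK // mul0mx => e.
  by rewrite -[x]pair_coordsK e /pair_of_coords !linear0.
- exists (pair_of_coords (pair_coords z *m invmx K)).
  by rewrite psi1E pair_of_coordsK mulmxKV // pair_coordsK.
Qed.

Lemma trform_adjoint_unique (psi1 psi2 psi2' : W -> W) :
  (forall x y, trform (psi1 x) (psi2 y) = trform x y) ->
  (forall x y, trform (psi1 x) (psi2' y) = trform x y) -> psi2 =1 psi2'.
Proof.
move=> P P' y; apply: trform_nondeg => z.
by have [_ _ /(_ z)[x <-]] := trform_preserving P; rewrite P P'.
Qed.

End Adjoint.

(** * Rank and trace preserving maps on pairs of blocks *)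

Section Classification.

Variable F : fieldType.

Lemma unitmx11 (d : 'M[F]_1) : (d \in unitmx) = (d != 0).
Proof.
rewrite unitmxE det_mx11 unitfE; congr (~~ _); apply/eqP/eqP => [e|->].
  by rewrite [d]mx11_scalar e raddf0.
by rewrite mxE.
Qed.

Lemma pair_rank_le1 m (w : 'M[F]_1 * 'M[F]_m) :
  (pair_rank w <= 1)%N -> w.1 != 0 -> w.2 = 0.
Proof.
rewrite /pair_rank -mxrank_eq0 => + r1; move: r1.
have := rank_leq_row w.1; case: (\rank w.1) => [|[|]] //= _ _.
by rewrite add1n ltnS leqn0 mxrank_eq0 => /eqP.
Qed.

Variables (m : nat) (psi1 psi2 : 'M[F]_1 * 'M[F]_m -> 'M[F]_1 * 'M[F]_m).
Hypothesis psiP : forall x y, trform (psi1 x) (psi2 y) = trform x y.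
Hypothesis psi1_rank :
  forall w, (pair_rank w <= 1)%N -> (pair_rank (psi1 w) <= 1)%N.

Let psi1_linear a x y : psi1 (a *: x + y) = a *: psi1 x + psi1 y.
Proof. by have [] := trform_preserving psiP. Qed.

Let psi1_ker x : psi1 x = 0 -> x = 0.
Proof. by have [_ + _] := trform_preserving psiP; apply. Qed.

Let psi1D x y : psi1 (x + y) = psi1 x + psi1 y.
Proof. by have := psi1_linear 1 x y; rewrite !scale1r. Qed.

Let psi1_0 : psi1 0 = 0.
Proof.
by have := psi1_linear (-1) 0 0; rewrite scaler0 addr0 scaleN1r addNr.
Qed.

Let psi1_split w : psi1 w = w.1 0 0 *: psi1 (1%:M, 0) + psi1 (0, w.2).
Proof.
rewrite -psi1_linear; congr psi1; case: w => c B /=.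
rewrite -[RHS]/(_ , _) /= addr0; congr (_, _); last by rewrite scaler0 add0r.
by rewrite [LHS]mx11_scalar scalemx1.
Qed.

Let block_part B := (psi1 (0, B)).2.

Let block_part_linear : linear block_part.
Proof.
move=> a A B; rewrite /block_part -[RHS]/((a *: psi1 (0, A) + psi1 (0, B)).2).
rewrite -psi1_linear; congr (psi1 _).2.
by rewrite -[RHS]/(_, _) /= scaler0 addr0.
Qed.

Let block_partL : {linear 'M[F]_m -> 'M[F]_m} :=
  HB.pack block_part
    (GRing.isLinear.Build F _ _ _ block_part block_part_linear).

Let scalar_part B := (psi1 (0, B)).1.

Let scalar_part_linear : linear scalar_part.
Proof.
move=> a A B; rewrite /scalar_part -[RHS]/((a *: psi1 (0, A) + psi1 (0, B)).1).
rewrite -psi1_linear; congr (psi1 _).1.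
by rewrite -[RHS]/(_, _) /= scaler0 addr0.
Qed.

Let scalar_partL : {linear 'M[F]_m -> 'M[F]_1} :=
  HB.pack scalar_part
    (GRing.isLinear.Build F _ _ _ scalar_part scalar_part_linear).

(** On the matrices x *m y with x fixed, the scalar component is a linear form
    in y, with a nonzero kernel vector z as m > 1.  If the form did not vanish
    at y, the rank condition would kill the block component at both y and
    y + z, hence the whole image of x *m z. *)
Lemma scalar_part_block : (1 < m)%N -> forall B, (psi1 (0, B)).1 = 0.
Proof.
move=> m_gt1.
have outer0 (x : 'cV_m) (y : 'rV_m) : (psi1 (0, x *m y)).1 = 0.
  have r1 (z : 'rV_m) : (pair_rank (psi1 (0, x *m z)%R) <= 1)%N.
    apply: psi1_rank; rewrite /pair_rank /= mxrank0 add0n.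
    by apply/rank_le1P; exists x, z.
  have [->|x0] := eqVneq x 0; first by rewrite mul0mx psi1_0.
  apply/eqP/negPn/negP => y1.
  pose c : 'cV[F]_m := lin1_mx (scalar_partL \o mulmx x).
  have cE (z : 'rV_m) : (psi1 (0, x *m z)).1 = z *m c by rewrite mul_rV_lin1.
  have [z z0 cz] : exists2 z : 'rV_m, z != 0 & z *m c = 0.
    have : kermx c != 0.
      rewrite kermx_eq0 /row_free neq_ltn; apply/orP; left.
      exact: leq_ltn_trans (rank_leq_col _) m_gt1.
    move=> /rowV0Pn[z /sub_kermxP zc z0]; by exists z.
  have By := pair_rank_le1 (r1 y) y1.
  have yz1 : (psi1 (0, x *m (y + z))).1 != 0 by rewrite cE mulmxDl cz addr0 -cE.
  have := pair_rank_le1 (r1 _) yz1.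
  rewrite mulmxDr.
  rewrite (_ : (0, x *m y + x *m z) = (0, x *m y) + (0, x *m z)); last first.
    by rewrite -[RHS]/(_, _) /= addr0.
  rewrite psi1D /= By add0r => Bz.
  have : psi1 (0, x *m z) = 0.
    by rewrite [LHS]surjective_pairing Bz cE cz.
  move=> /psi1_ker [] /eqP; rewrite outer_eq0 (negPf x0) /=.
  by apply/negP.
move=> B; rewrite -[LHS]/(scalar_partL B) [B]matrix_sum_delta.
rewrite linear_sum big1 // => i _.
rewrite linear_sum big1 // => j _.
by rewrite linearZ /= -(mul_delta_mx (0 : 'I_1)) /scalar_part outer0 scaler0.
Qed.

(** The image of (1, 0) cannot have a block component: it would then equal the
    image of some (0, B).  The formula for psi2 follows from that for psi1,
    because the adjoint is unique. *)
Lemma classify_block : (1 < m)%N ->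
  exists (d : 'M[F]_1) (U V : 'M[F]_m),
  [/\ d \in unitmx, U \in unitmx, V \in unitmx &
      (forall w, psi1 w = (d *m w.1, U *m w.2 *m V) /\
         psi2 w = (w.1 *m invmx d, invmx V *m w.2 *m invmx U)) \/
      (forall w, psi1 w = (d *m w.1, U *m w.2^T *m V) /\
         psi2 w = (w.1 *m invmx d, invmx V *m w.2^T *m invmx U))].
Proof.
move=> m_gt1; have bb := scalar_part_block m_gt1.
have TE B : psi1 (0, B) = (0, block_partL B).
  by rewrite [LHS]surjective_pairing bb.
have T_inj B : block_partL B = 0 -> B = 0.
  by move=> TB0; have := TE B; rewrite TB0 => /psi1_ker[].
have T_rank B : (\rank B <= 1)%N -> (\rank (block_partL B) <= 1)%N.
  move=> rB; have := @psi1_rank (0, B).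
  by rewrite TE /pair_rank /= mxrank0 !add0n; apply.
have [U [V [uU uV UV]]] := rank_one_preserver T_inj T_rank.
have T_surj D : exists B, block_partL B = D.
  case: UV => e; [exists (invmx U *m D *m invmx V)|
                  exists (invmx U *m D *m invmx V)^T];
  by rewrite e ?trmxK !mulmxA mulmxV // mul1mx mulmxKV.
set d := (psi1 (1%:M, 0)).1.
have psi_1 : psi1 (1%:M, 0) = (d, 0).
  have r1 : (pair_rank (psi1 (1%:M, 0)%R) <= 1)%N.
    by apply: psi1_rank; rewrite /pair_rank /= mxrank1 mxrank0.
  have [d0|d0] := eqVneq d 0; last first.
    by rewrite [LHS]surjective_pairing (pair_rank_le1 r1 d0).
  have [B hB] := T_surj (psi1 (1%:M, 0)).2.
  have : psi1 (1%:M, 0) = psi1 (0, B).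
    by rewrite TE hB -d0 -surjective_pairing.
  move=> e; have : psi1 (-1 *: (0, B) + (1%:M, 0)) = 0.
    by rewrite psi1_linear e scaleN1r addNr.
  move=> /psi1_ker[] /eqP.
  by rewrite scaler0 add0r oner_eq0.
have ud : d \in unitmx.
  rewrite unitmx11; apply/eqP => d0; have := psi_1.
  by rewrite d0 => /psi1_ker[] /eqP; rewrite oner_eq0.
have psi1E w : psi1 w = (d *m w.1, block_partL w.2).
  rewrite psi1_split psi_1 TE; rewrite -[LHS]/(_, _) /= scaler0 add0r addr0.
  by rewrite [in RHS](mx11_scalar w.1) mul_mx_scalar.
have psi2E (psi2' : 'M[F]_1 * 'M[F]_m -> 'M[F]_1 * 'M[F]_m) :
    (forall x y, \tr (d *m x.1 *m (psi2' y).1) +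
       \tr (block_partL x.2 *m (psi2' y).2) = trform x y) -> psi2 =1 psi2'.
  move=> e; apply: (trform_adjoint_unique psiP) => x y.
  by rewrite psi1E /trform /= e.
have trd (a b : 'M[F]_1) : \tr (d *m a *m (b *m invmx d)) = \tr (a *m b).
  by rewrite mxtrace_mulC !mulmxA mulmxKV // mxtrace_mulC.
have trUV (a b : 'M[F]_m) :
    \tr (U *m a *m V *m (invmx V *m b *m invmx U)) = \tr (a *m b).
  by rewrite !mulmxA mulmxK // mxtrace_mulC !mulmxA mulVmx // mul1mx.
exists d, U, V; split=> //; case: UV => UV; [left|right] => w.
- split; first by rewrite psi1E UV.
  pose p (w : 'M[F]_1 * 'M[F]_m) :=
    (w.1 *m invmx d, invmx V *m w.2 *m invmx U).
  by rewrite -/(p w); apply: psi2E => x y; rewrite UV /= trd trUV.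
- split; first by rewrite psi1E UV.
  pose p (w : 'M[F]_1 * 'M[F]_m) :=
    (w.1 *m invmx d, invmx V *m w.2^T *m invmx U).
  rewrite -/(p w); apply: psi2E => x y; rewrite UV /= trd trUV.
  by rewrite -trmx_mul mxtrace_tr [\tr (y.2 *m _)]mxtrace_mulC.
Qed.

End Classification.

(** In dimension two, pairs of rank at most 1 form the two coordinate axes; the
    basis vectors go to distinct axes, otherwise some combination of them would
    be killed. *)
Lemma classify_scalar (F : fieldType)
    (psi1 psi2 : 'M[F]_1 * 'M[F]_1 -> 'M[F]_1 * 'M[F]_1) :
  (forall x y, trform (psi1 x) (psi2 y) = trform x y) ->
  (forall w, (pair_rank w <= 1)%N -> (pair_rank (psi1 w) <= 1)%N) ->
  exists d d' : 'M[F]_1, [/\ d \in unitmx, d' \in unitmx &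
    (forall w, psi1 w = (d *m w.1, d' *m w.2) /\
               psi2 w = (w.1 *m invmx d, w.2 *m invmx d')) \/
    (forall w, psi1 w = (d *m w.2, d' *m w.1) /\
               psi2 w = (w.2 *m invmx d, w.1 *m invmx d'))].
Proof.
move=> psiP psi_rank; have [psi_lin psi_ker _] := trform_preserving psiP.
have psiE w : psi1 w = w.1 0 0 *: psi1 (1%:M, 0) + w.2 0 0 *: psi1 (0, 1%:M).
  have psi0 : psi1 0 = 0.
    by have := psi_lin (-1) 0 0; rewrite scaler0 addr0 scaleN1r addNr.
  rewrite -[_ *: psi1 (0, _)]addr0 -psi0 -!psi_lin; congr psi1.
  case: w => a b; rewrite -[RHS]/(_, _) /= !scaler0 !addr0 add0r !scalemx1.
  by rewrite -!mx11_scalar.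
have axis w : (pair_rank (psi1 w) <= 1)%N -> psi1 w != 0 ->
    exists2 d, d \in unitmx & psi1 w = (d, 0) \/ psi1 w = (0, d).
  move=> r1 w0.
  have [a0|a0] := eqVneq (psi1 w).1 0; last first.
    exists (psi1 w).1; rewrite ?unitmx11 //; left.
    by rewrite [LHS]surjective_pairing (pair_rank_le1 r1 a0).
  exists (psi1 w).2; last by right; rewrite [LHS]surjective_pairing a0.
  rewrite unitmx11; apply: contraNneq w0 => b0.
  by rewrite [psi1 w]surjective_pairing a0 b0.
have [||d ud hd] := axis (1%:M, 0).
- by apply: psi_rank; rewrite /pair_rank /= mxrank1 mxrank0.
- by apply/eqP => /psi_ker[] /eqP; rewrite oner_eq0.
have [||d' ud' hd'] := axis (0, 1%:M).
- by apply: psi_rank; rewrite /pair_rank /= mxrank1 mxrank0.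
- by apply/eqP => /psi_ker[] /eqP; rewrite oner_eq0.
have two_axes (p q : 'M[F]_1 * 'M[F]_1) (a b : F) :
    psi1 (1%:M, 0) = p -> psi1 (0, 1%:M) = q -> a *: p + b *: q = 0 -> a = 0.
  move=> <- <- e; have := psiE (a%:M, b%:M).
  rewrite /= !mxE !eqxx !mulr1n e => /psi_ker[] /eqP.
  by rewrite -scalemx1 scaler_eq0 oner_eq0 orbF => /eqP.
have absurd : forall p q : 'M[F]_1 * 'M[F]_1,
    psi1 (1%:M, 0) = p -> psi1 (0, 1%:M) = q ->
    d' 0 0 *: p + - d 0 0 *: q = 0 -> False.
  move=> p q hp hq /(two_axes _ _ _ _ hp hq) d'0.
  by move: ud'; rewrite unitmx11 [d']mx11_scalar d'0 raddf0 eqxx.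
have zero2 : d' 0 0 *: d + - d 0 0 *: d' = 0.
  by apply/matrixP => i j; rewrite !ord1 !mxE mulNr mulrC subrr.
have tr1 (e a b : 'M[F]_1) : e \in unitmx ->
    \tr (e *m a *m (b *m invmx e)) = \tr (a *m b).
  by move=> ue; rewrite mxtrace_mulC !mulmxA mulmxKV // mxtrace_mulC.
case: hd hd' => hd [] hd'.
- by case: (absurd _ _ hd hd'); rewrite -[LHS]/(_, _) /= zero2 !scaler0 addr0.
- exists d, d'; split=> //; left.
  have E w : psi1 w = (d *m w.1, d' *m w.2).
    rewrite psiE hd hd' -[LHS]/(_, _) /= !scaler0 addr0 add0r.
    by rewrite {2}[w.1]mx11_scalar {2}[w.2]mx11_scalar !mul_mx_scalar.
  move=> w; split=> //.
  pose p (w : 'M[F]_1 * 'M[F]_1) := (w.1 *m invmx d, w.2 *m invmx d').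
  rewrite -/(p w); apply: (trform_adjoint_unique psiP) => x y.
  by rewrite E /trform /= !tr1.
- exists d', d; split=> //; right.
  have E w : psi1 w = (d' *m w.2, d *m w.1).
    rewrite psiE hd hd' -[LHS]/(_, _) /= !scaler0 addr0 add0r.
    by rewrite {2}[w.1]mx11_scalar {2}[w.2]mx11_scalar !mul_mx_scalar.
  move=> w; split=> //.
  pose p (w : 'M[F]_1 * 'M[F]_1) := (w.2 *m invmx d', w.1 *m invmx d).
  rewrite -/(p w); apply: (trform_adjoint_unique psiP) => x y.
  by rewrite E /trform /= !tr1 // addrC.
- by case: (absurd _ _ hd hd'); rewrite -[LHS]/(_, _) /= zero2 !scaler0 addr0.
Qed.

(** * Spectra, traces and idempotents *)
Lemma eq_spec (R : realType) (n : nat) (A B : 'M[R]_n) :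
  spec A = spec B <-> char_poly A = char_poly B.
Proof.
rewrite /spec -!map_char_poly; split=> [|->//].
case: closed_field_poly_normal => s /= sE.
case: closed_field_poly_normal => t /= tE.
move=> /eq_seq_msetP st; apply: (map_poly_inj (real_complex R)).
rewrite sE tE !lead_coef_map !(monicP (char_poly_monic _)).
by rewrite (perm_big _ st).
Qed.

Lemma mxtrace_char_poly (R : nzRingType) (n : nat) (A B : 'M[R]_n) :
  char_poly A = char_poly B -> \tr A = \tr B.
Proof.
case: n A B => [|n] A B AB; first by rewrite /mxtrace !big_ord0.
by apply: oppr_inj; rewrite -!char_poly_trace // AB.
Qed.

(** An eigenvector y of u *m v for a != 0 is a multiple of v, and v is an
    eigenvector for the scalar v *m u, the trace. *)
Lemma rank_le1_eigenvalue (F : fieldType) (n : nat) (A : 'M[F]_n) (a : F) :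
  (\rank A <= 1)%N -> a != 0 -> eigenvalue A a -> \tr A = a.
Proof.
move=> /rank_le1P[u [v ->]] a0 /eigenvalueP[y].
rewrite mulmxA [y *m u]mx11_scalar mul_scalar_mx; set k := (y *m u) 0 0.
move=> yE y0; have yv : y = (k / a) *: v.
  by rewrite mulrC -scalerA yE scalerA mulVf // scale1r.
have k0 : k / a != 0 by apply: contraNneq y0 => k0; rewrite yv k0 scale0r.
rewrite mxtrace_mulC trace_mx11; apply: (mulfI k0).
transitivity k; last by rewrite mulfVK.
by rewrite -[RHS]/((y *m u) 0 0) [in RHS]yv -scalemxAl [RHS]mxE.
Qed.

Lemma eigenvalue_idempotent (F : fieldType) (n : nat) (A : 'M[F]_n) :
  A *m A = A -> A != 0 -> eigenvalue A 1.
Proof.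
move=> AA A0; apply/eigenvalueP.
have /rowV0Pn[y /submxP[z ->] y0] := A0.
by exists (z *m A) => //; rewrite -mulmxA AA scale1r.
Qed.

Lemma mulmx_pinv_idem (F : fieldType) (n : nat) (A : 'M[F]_n) :
  A *m pinvmx A *m (A *m pinvmx A) = A *m pinvmx A.
Proof. by rewrite [LHS]mulmxA mulmxKpV. Qed.

(** Up to conjugation, A *m pinvmx A is the partial identity of rank \rank A. *)
Lemma mxtrace_mul_pinv (F : fieldType) (n : nat) (A : 'M[F]_n) :
  \tr (A *m pinvmx A) = (\rank A)%:R.
Proof.
rewrite -{1}[A]mulmx_ebase /pinvmx.
rewrite mxtrace_mulC !mulmxA mulmxKV ?col_ebase_unit //.
rewrite -!mulmxA mxtrace_mulC !mulmxA mulmxK ?row_ebase_unit //.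
rewrite mul_pid_mx minnn (minn_idPr (rank_leq_row A)).
rewrite /mxtrace; under eq_bigr => i _ do rewrite mxE eqxx /=.
rewrite -natr_sum; congr _%:R.
have r_sum : (\sum_(i < \rank A) 1 = \rank A)%N.
  by rewrite sum_nat_const card_ord muln1.
rewrite -[RHS]r_sum (big_ord_widen n (fun=> 1%N) (rank_leq_row A)).
rewrite [RHS]big_mkcond.
by apply: eq_bigr => i _; case: ifP.
Qed.

(** * The span of the doubly stochastic matrices *)
Lemma spanDS_sums (R : realType) (n : nat) (A : 'M[R]_n) : spanDS R n A ->
  exists c, A *m const_mx 1 = c *: const_mx 1 :> 'cV_n /\
            const_mx 1 *m A = c *: const_mx 1 :> 'rV_n.
Proof.
case=> k [c [s [sDS ->]]]; exists (\sum_i c i).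
split; rewrite ?mulmx_suml ?mulmx_sumr scaler_suml; apply: eq_bigr => i _.
  have [_ rs _] := sDS i; rewrite -scalemxAl; congr (_ *: _).
  apply/colP => j; rewrite !mxE -[RHS](rs j).
  by apply: eq_bigr => l _; rewrite mxE mulr1.
have [_ _ cs] := sDS i; rewrite -scalemxAr; congr (_ *: _).
apply/rowP => j; rewrite !mxE -[RHS](cs j).
by apply: eq_bigr => l _; rewrite mxE mul1r.
Qed.

(** Adding a large constant t to all entries makes A positive; A + t is then a
    multiple of a doubly stochastic matrix, and so is the constant matrix. *)
Lemma spanDS_of_sums (R : realType) (n : nat) (A : 'M[R]_n) (c : R) :
  A *m const_mx 1 = c *: const_mx 1 :> 'cV_n ->
  const_mx 1 *m A = c *: const_mx 1 :> 'rV_n -> spanDS R n A.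
Proof.
case: n A => [|n] A Ae eA.
  by exists 0%N, (fun=> 0), (fun=> 0); split=> [[]//|]; apply/matrixP => -[].
have rs i : \sum_j A i j = c.
  have /colP/(_ i) := Ae; rewrite !mxE mulr1 => <-.
  by apply: eq_bigr => j _; rewrite mxE mulr1.
have cs j : \sum_i A i j = c.
  have /rowP/(_ j) := eA; rewrite !mxE mulr1 => <-.
  by apply: eq_bigr => i _; rewrite mxE mul1r.
pose t := 1 + \sum_i \sum_j `|A i j|.
have At i j : 0 < A i j + t.
  have : `|A i j| <= \sum_i \sum_j `|A i j|.
    rewrite (bigD1 i) //= (bigD1 j) //= -addrA lerDl addr_ge0 //.
      by apply: sumr_ge0.
    by do 2!apply: sumr_ge0 => ? _.
  have := ler_norm (- A i j); rewrite normrN /t; lra.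
pose N : R := n.+1%:R.
have N0 : N != 0 by rewrite pnatr_eq0.
have rt i : \sum_j (A i j + t) = c + t * N.
  by rewrite big_split /= rs sumr_const card_ord mulr_natr.
have ct j : \sum_i (A i j + t) = c + t * N.
  by rewrite big_split /= cs sumr_const card_ord mulr_natr.
have k0 : 0 < c + t * N.
  rewrite -(rt ord0) (bigD1 ord0) //= ltr_pwDl //.
  by apply: sumr_ge0 => j _; apply: ltW.
pose D := (c + t * N)^-1 *: (A + const_mx t).
pose J : 'M[R]_n.+1 := const_mx N^-1.
exists 2%N, (fun i => if i == 0 then c + t * N else - (t * N)),
  (fun i => if i == 0 then D else J); split=> [i|].
  case: ifP => _; split=> [p q|p|q].
  - by rewrite !mxE mulr_ge0 ?invr_ge0 ?ltW.
  - under eq_bigr => j _ do rewrite !mxE.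
    by rewrite -mulr_sumr rt mulVf // gt_eqF.
  - under eq_bigr => j _ do rewrite !mxE.
    by rewrite -mulr_sumr ct mulVf // gt_eqF.
  - by rewrite mxE invr_ge0 ler0n.
  - under eq_bigr => j _ do rewrite !mxE.
    by rewrite sumr_const card_ord -mulr_natl mulfV.
  - under eq_bigr => j _ do rewrite !mxE.
    by rewrite sumr_const card_ord -mulr_natl mulfV.
rewrite big_ord_recl big_ord1 /= /D scalerA mulfV ?gt_eqF // scale1r.
by apply/matrixP => i j; rewrite !mxE mulNr mulfK // addrK.
Qed.

(** H is the reflection exchanging the unit vectors f = e_0 and e / s, where
    s = sqrt n is the norm of the all-ones vector e: it is 1 - k v v^T with
    v = f - e / s and k = 2 / (v^T v) = s / (s - 1). *)
Lemma householder (R : realType) (m : nat) : (0 < m)%N ->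
  exists (H : 'M[R]_(1 + m)) (s : R), [/\ s != 0, H^T = H, H *m H = 1%:M &
    H *m const_mx 1 = s *: (col_mx 1%:M 0 : 'cV_(1 + m))].
Proof.
move=> m0; pose N : R := (1 + m)%:R; pose s := Num.sqrt N.
have ss : s * s = N by rewrite -expr2 sqr_sqrtr // ler0n.
have N1 : 1 < N by rewrite ltr1n.
have s1 : 1 < s by rewrite -sqrtr1 ltr_sqrt // (lt_trans ltr01).
have s0 : s != 0 by rewrite gt_eqF // (lt_trans ltr01).
have s10 : s - 1 != 0 by rewrite subr_eq0 gt_eqF.
pose e : 'cV[R]_(1 + m) := const_mx 1.
pose f : 'cV[R]_(1 + m) := col_mx 1%:M 0.
have ff : f^T *m f = 1%:M.
  by rewrite tr_col_mx mul_row_col trmx1 mulmx1 mulmx0 addr0.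
have fe : f^T *m e = 1%:M.
  rewrite tr_col_mx /e -col_mx_const mul_row_col trmx1 mul1mx.
  by rewrite trmx0 mul0mx addr0; apply/matrixP => i j; rewrite !ord1 !mxE.
have ef : e^T *m f = 1%:M by rewrite -[LHS]trmxK trmx_mul trmxK fe trmx1.
have ee : e^T *m e = N%:M.
  apply/matrixP => i j; rewrite !ord1 !mxE eqxx mulr1n.
  under eq_bigr => k _ do rewrite !mxE mulr1.
  by rewrite sumr_const card_ord.
pose v := f - s^-1 *: e.
have vT : v^T = f^T - s^-1 *: e^T by rewrite linearB /= linearZ.
have vv : v^T *m v = (2 * (s - 1) / s)%:M.
  rewrite vT /v !mulmxBr !mulmxBl -!scalemxAl -!scalemxAr ff fe ef ee -ss.
  by rewrite !scale_scalar_mx !mulr1 -!raddfB; congr (_%:M); field.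
have ve : v^T *m e = (1 - s)%:M.
  rewrite vT mulmxBl -scalemxAl fe ee -ss scale_scalar_mx mulKf //.
  by rewrite raddfB.
pose k := s / (s - 1).
exists (1%:M - k *: (v *m v^T)), s; split=> //.
- by rewrite linearB /= linearZ /= trmx_mul trmxK trmx1.
- set P := v *m v^T.
  have PP : P *m P = (2 * (s - 1) / s) *: P.
    by rewrite /P mulmxA -[v *m v^T *m v]mulmxA vv mul_mx_scalar -scalemxAl.
  have kk : k * k * (2 * (s - 1) / s) = k + k by rewrite /k; field; rewrite s10.
  rewrite mulmxBl mul1mx mulmxBr mulmx1 -scalemxAl -scalemxAr PP !scalerA kk.
  by rewrite scalerDl opprB addrK subrK.
- rewrite mulmxBl mul1mx -scalemxAl -mulmxA ve mul_mx_scalar scalerA.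
  have -> : k * (1 - s) = - s by rewrite /k; field.
  by rewrite scaleNr opprK /v scalerBr scalerA mulfV // scale1r addrC subrK.
Qed.

(** * Block coordinates on the span *)

Section Encoding.

Variables (R : realType) (m : nat) (H : 'M[R]_(1 + m)) (s : R).
Hypothesis s_neq0 : s != 0.
Hypothesis H_sym : H^T = H.
Hypothesis H_invol : H *m H = 1%:M.
Hypothesis H_ones : H *m const_mx 1 = s *: (col_mx 1%:M 0 : 'cV_(1 + m)).

Local Notation W := ('M[R]_1 * 'M[R]_m)%type.

Definition of_blocks (w : W) : 'M[R]_(1 + m) := H *m block_mx w.1 0 0 w.2 *m H.
Definition to_blocks (A : 'M[R]_(1 + m)) : W :=
  (ulsubmx (H *m A *m H), drsubmx (H *m A *m H)).

Lemma reflectK (A : 'M[R]_(1 + m)) : H *m (H *m A *m H) *m H = A.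
Proof. by rewrite !mulmxA H_invol mul1mx -mulmxA H_invol mulmx1. Qed.

Lemma H_axis : H *m (col_mx 1%:M 0 : 'cV_(1 + m)) = s^-1 *: const_mx 1.
Proof.
apply: (scalerI s_neq0); rewrite scalemxAr -H_ones mulmxA H_invol mul1mx.
by rewrite scalerA mulfV // scale1r.
Qed.

Lemma of_blocks_ones w :
  of_blocks w *m const_mx 1 = w.1 0 0 *: const_mx 1 :> 'cV_(1 + m).
Proof.
rewrite /of_blocks -mulmxA H_ones -scalemxAr -mulmxA mul_block_col.
rewrite !mul0mx mulmx0 mulmx1.
have -> : col_mx (w.1 + 0) (0 + 0) = w.1 0 0 *: (col_mx 1%:M 0 : 'cV_(1 + m)).
  by rewrite !addr0 scale_col_mx scaler0 scalemx1 -mx11_scalar.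
by rewrite -scalemxAr H_axis !scalerA mulrAC mulfV // mul1r.
Qed.

Lemma tr_of_blocks w : (of_blocks w)^T = of_blocks (w.1, w.2^T).
Proof.
rewrite /of_blocks !trmx_mul H_sym mulmxA tr_block_mx !trmx0.
by rewrite [w.1]mx11_scalar tr_scalar_mx -mx11_scalar.
Qed.

Lemma ones_of_blocks w :
  const_mx 1 *m of_blocks w = w.1 0 0 *: const_mx 1 :> 'rV_(1 + m).
Proof.
apply: trmx_inj; rewrite trmx_mul tr_of_blocks linearZ /= !trmx_const.
exact: of_blocks_ones.
Qed.

Lemma of_blocks_span w : spanDS R (1 + m) (of_blocks w).
Proof. exact: spanDS_of_sums (of_blocks_ones w) (ones_of_blocks w). Qed.

(** The reflection turns the two eigenvector conditions on the all-ones vector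
    into the vanishing of the lower left and upper right blocks; the second
    follows from the first applied to the transpose. *)
Lemma to_blocksK A : spanDS R (1 + m) A -> of_blocks (to_blocks A) = A.
Proof.
move=> /spanDS_sums[c [Ae eA]]; rewrite /of_blocks /to_blocks /=.
rewrite -[RHS]reflectK; congr (H *m _ *m H).
set M := H *m A *m H; rewrite -[RHS]submxK.
have axis (B : 'M[R]_(1 + m)) :
    B *m const_mx 1 = c *: const_mx 1 :> 'cV_(1 + m) ->
    dlsubmx (H *m B *m H) = 0.
  move=> Be; have : H *m B *m H *m (col_mx 1%:M 0 : 'cV_(1 + m)) =
                    c *: col_mx 1%:M 0.
    rewrite -mulmxA H_axis -scalemxAr -mulmxA Be -scalemxAr H_ones !scalerA.
    by rewrite mulrAC mulVf // mul1r.
  rewrite -{1}[H *m B *m H]submxK mul_block_col !mulmx0 !mulmx1 !addr0.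
  by rewrite scale_col_mx scaler0 => /eq_col_mx[].
have ML : dlsubmx M = 0 by apply: axis.
have MU : ursubmx M = 0.
  apply: trmx_inj; rewrite trmx_ursub trmx0 /M !trmx_mul H_sym mulmxA.
  apply: axis; have := congr1 trmx eA.
  by rewrite trmx_mul linearZ /= !trmx_const.
by rewrite ML MU.
Qed.

Lemma of_blocksM w w' :
  of_blocks w *m of_blocks w' = of_blocks (w.1 *m w'.1, w.2 *m w'.2).
Proof.
rewrite /of_blocks !mulmxA; congr (_ *m H).
rewrite -[_ *m H *m H]mulmxA H_invol mulmx1 -mulmxA mulmx_block.
by rewrite !mulmx0 !mul0mx !addr0 !add0r.
Qed.

Lemma of_blocks1 : of_blocks (1%:M, 1%:M) = 1%:M.
Proof. by rewrite /of_blocks -scalar_mx_block mulmx1. Qed.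

Lemma mxtrace_of_blocks w : \tr (of_blocks w) = \tr w.1 + \tr w.2.
Proof.
by rewrite /of_blocks mxtrace_mulC mulmxA H_invol mul1mx mxtrace_block.
Qed.

Lemma mxtrace_of_blocksM w w' : \tr (of_blocks w *m of_blocks w') = trform w w'.
Proof. by rewrite of_blocksM mxtrace_of_blocks. Qed.

Lemma rank_of_blocks w : \rank (of_blocks w) = pair_rank w.
Proof.
have [uH _] := mulmx1_unit H_invol.
rewrite /of_blocks mxrankMfree ?row_free_unit // eqmxMfull ?row_full_unit //.
exact: rank_diag_block_mx.
Qed.

Lemma unitmx_of_blocks w :
  w.1 \in unitmx -> w.2 \in unitmx -> of_blocks w \in unitmx.
Proof.
move=> u1 u2.
suff /mulmx1_unit[] :
  of_blocks w *m of_blocks (invmx w.1, invmx w.2) = 1%:M by [].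
by rewrite of_blocksM !mulmxV // of_blocks1.
Qed.

Lemma invmx_of_blocks w : w.1 \in unitmx -> w.2 \in unitmx ->
  invmx (of_blocks w) = of_blocks (invmx w.1, invmx w.2).
Proof.
move=> u1 u2; rewrite -[LHS]mulmx1 -of_blocks1 -(mulmxV u1) -(mulmxV u2).
rewrite -[of_blocks (_, _)](of_blocksM w (invmx w.1, invmx w.2)) mulKmx //.
exact: unitmx_of_blocks.
Qed.

Definition span_of_blocks (w : W) : spanDS R (1 + m) :=
  SigSub (mem_set (of_blocks_span w)).

Lemma span_of_blocksK (A : spanDS R (1 + m)) :
  span_of_blocks (to_blocks (val A)) = A.
Proof. by apply: val_inj; rewrite /= to_blocksK //; apply: set_valP. Qed.

Section Conjugate.

Variable phi : spanDS R (1 + m) -> spanDS R (1 + m).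

Definition on_blocks (w : W) : W := to_blocks (val (phi (span_of_blocks w))).

Lemma of_on_blocks w : of_blocks (on_blocks w) = val (phi (span_of_blocks w)).
Proof. by rewrite to_blocksK //; apply: set_valP. Qed.

Lemma val_on_blocks A : val (phi A) = of_blocks (on_blocks (to_blocks (val A))).
Proof. by rewrite of_on_blocks span_of_blocksK. Qed.

Lemma on_blocks_rank :
  (forall A : spanDS R (1 + m),
     (\rank (val A) <= 1)%N -> (\rank (val (phi A)) <= 1)%N) ->
  forall w, (pair_rank w <= 1)%N -> (pair_rank (on_blocks w) <= 1)%N.
Proof.
by move=> rk w; rewrite -!rank_of_blocks of_on_blocks => ?; apply: rk.
Qed.

End Conjugate.

End Encoding.

(** * The three conditions *)
Lemma char_poly_tr (F : comNzRingType) (n : nat) (A : 'M[F]_n) :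
  char_poly A^T = char_poly A.
Proof.
rewrite /char_poly -[RHS]det_tr; congr (\det _).
by rewrite /char_poly_mx linearB /= tr_scalar_mx map_trmx.
Qed.

Section Conditions.

Variables (R : realType) (n : nat) (phi1 phi2 : spanDS R n -> spanDS R n).

Definition trace_condition := forall A1 A2 : spanDS R n,
  \tr (val (phi1 A1) *m val (phi2 A2)) = \tr (val A1 *m val A2).

Definition rank_condition (phi : spanDS R n -> spanDS R n) :=
  forall A : spanDS R n, (\rank (val A) <= 1)%N -> (\rank (val (phi A)) <= 1)%N.

Definition spec_condition := forall A1 A2 : spanDS R n,
  spec (val (phi1 A1) *m val (phi2 A2)) = spec (val A1 *m val A2).

Definition standard_form :=
  (n = 2%N /\
   exists C P : 'M[R]_n,
     [/\ C \in unitmx, spanDS R n C,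
         P = 1%:M \/ P = diag_mx (\row_j (-1) ^+ j),
         forall A : spanDS R n,
           val (phi1 A) = C *m P *m val A *m invmx P
       & forall A : spanDS R n,
           val (phi2 A) = P *m val A *m invmx P *m invmx C]) \/
  ((3 <= n)%N /\
   exists P Q : 'M[R]_n,
     [/\ P \in unitmx, spanDS R n P, Q \in unitmx, spanDS R n Q &
         (forall A : spanDS R n,
            val (phi1 A) = P *m val A *m invmx Q /\
            val (phi2 A) = Q *m val A *m invmx P) \/
         (forall A : spanDS R n,
            val (phi1 A) = P *m (val A)^T *m invmx Q /\
            val (phi2 A) = Q *m (val A)^T *m invmx P)]).

Lemma sign_diag_sqr :
  diag_mx (\row_j (-1) ^+ j) *m diag_mx (\row_j (-1) ^+ j) = 1%:M :> 'M[R]_n.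
Proof.
rewrite mulmx_diag -diag_const_mx; congr diag_mx.
by apply/rowP => j; rewrite !mxE -expr2 sqrr_sign.
Qed.

Lemma standard_form_spec : standard_form -> spec_condition.
Proof.
move=> [[n2 [C [P [uC _ hP h1 h2]]]]|[_ [P [Q [uP _ uQ _ hPQ]]]]] A1 A2;
    apply/eq_spec.
  have uP : P \in unitmx.
    case: hP => ->; first exact: unitmx1.
    by have [] := mulmx1_unit sign_diag_sqr.
  have -> : val (phi1 A1) *m val (phi2 A2) =
      C *m (P *m (val A1 *m val A2) *m invmx P) *m invmx C.
    by rewrite h1 h2 !mulmxA mulmxKV.
  by rewrite !char_poly_conj.
case: hPQ => h; have [-> _] := h A1; have [_ ->] := h A2.
  have -> : P *m val A1 *m invmx Q *m (Q *m val A2 *m invmx P) =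
      P *m (val A1 *m val A2) *m invmx P by rewrite !mulmxA mulmxKV.
  by rewrite char_poly_conj.
have -> : P *m (val A1)^T *m invmx Q *m (Q *m (val A2)^T *m invmx P) =
    P *m (val A2 *m val A1)^T *m invmx P by rewrite trmx_mul !mulmxA mulmxKV.
by rewrite char_poly_conj // char_poly_tr char_poly_mulC.
Qed.

Lemma spec_trace : spec_condition -> trace_condition.
Proof. by move=> h A1 A2; apply/mxtrace_char_poly/eq_spec. Qed.

Lemma standard_form_rank : standard_form -> rank_condition phi1.
Proof.
have rk (X Y Z : 'M[R]_n) : (\rank Y <= 1)%N -> (\rank (X *m Y *m Z) <= 1)%N.
  apply: leq_trans; apply: leq_trans (mxrankM_maxl _ _) (mxrankM_maxr _ _).
move=> [[n2 [C [P [_ _ _ h1 _]]]]|[_ [P [Q [_ _ _ _ hPQ]]]]] A rA.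
  by rewrite h1; apply: rk.
case: hPQ => h; have [-> _] := h A; apply: rk => //.
by rewrite mxrank_tr.
Qed.

End Conditions.

Lemma mulmx11C (F : fieldType) (a b : 'M[F]_1) : a *m b = b *m a.
Proof. by rewrite [a]mx11_scalar scalar_mxC. Qed.

Section Encoded.

Variables (R : realType) (m : nat) (H : 'M[R]_(1 + m)) (s : R).
Hypothesis s_neq0 : s != 0.
Hypothesis H_sym : H^T = H.
Hypothesis H_invol : H *m H = 1%:M.
Hypothesis H_ones : H *m const_mx 1 = s *: (col_mx 1%:M 0 : 'cV_(1 + m)).

Local Notation of_blocks := (of_blocks H).
Local Notation to_blocks := (to_blocks H).
Local Notation span_of_blocks := (span_of_blocks s_neq0 H_sym H_invol H_ones).
Local Notation on_blocks := (on_blocks s_neq0 H_sym H_invol H_ones).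

Variables phi1 phi2 : spanDS R (1 + m) -> spanDS R (1 + m).

Let psi1 := on_blocks phi1.
Let psi2 := on_blocks phi2.

Let phi1E A : val (phi1 A) = of_blocks (psi1 (to_blocks (val A))).
Proof. exact: val_on_blocks. Qed.

Let phi2E A : val (phi2 A) = of_blocks (psi2 (to_blocks (val A))).
Proof. exact: val_on_blocks. Qed.

Let span_to_blocks (A : spanDS R (1 + m)) :
  of_blocks (to_blocks (val A)) = val A.
Proof.
by apply: to_blocksK s_neq0 H_sym H_invol H_ones _ _; apply: set_valP.
Qed.

Lemma trform_on_blocks : trace_condition phi1 phi2 ->
  forall x y, trform (psi1 x) (psi2 y) = trform x y.
Proof.
move=> tr x y; rewrite -!(mxtrace_of_blocksM H_invol) !of_on_blocks.
exact: tr.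
Qed.

(** Let x be the pair of phi1 A.  Choosing y with psi2 y the pair of
    pseudoinverses of the blocks of x makes E, the product of the two images,
    idempotent of trace the rank of x.  It has the characteristic polynomial of
    A times a matrix, whose only possible nonzero eigenvalue is its trace. *)
Lemma spec_rank : spec_condition phi1 phi2 -> rank_condition phi1.
Proof.
move=> sp A rA; rewrite phi1E rank_of_blocks //; set x := psi1 _.
have psiP := trform_on_blocks (spec_trace sp).
have [_ _ psi2_surj] :
  [/\ forall a x y, psi2 (a *: x + y) = a *: psi2 x + psi2 y,
    forall x, psi2 x = 0 -> x = 0 & forall z, exists y, psi2 y = z].
  apply: (@trform_preserving _ _ psi2 psi1) => y z.
  by rewrite trformC psiP trformC.
have [y yE] := psi2_surj (pinvmx x.1, pinvmx x.2).
pose E := of_blocks x *m of_blocks (psi2 y).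
have trE : \tr E = (pair_rank x)%:R.
  by rewrite mxtrace_of_blocksM // yE /trform !mxtrace_mul_pinv -natrD.
have EE : E *m E = E.
  have of_pairsM a b a' b' : of_blocks (a, b) *m of_blocks (a', b') =
      of_blocks (a *m a', b *m b').
    exact: of_blocksM.
  rewrite /E yE (_ : of_blocks x = of_blocks (x.1, x.2)); last first.
    by rewrite -surjective_pairing.
  by rewrite !of_pairsM !mulmx_pinv_idem.
have cE : char_poly E = char_poly (val A *m of_blocks y).
  have /eq_spec := sp A (span_of_blocks y).
  by rewrite phi1E -of_on_blocks.
have [x0|x0] := posnP (pair_rank x); first by rewrite x0.
have E0 : E != 0.
  apply/eqP => E0; move: trE; rewrite E0 mxtrace0 => /esym/eqP.
  by rewrite pnatr_eq0 -leqn0 leqNgt x0.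
have : \tr (val A *m of_blocks y) = 1.
  apply: rank_le1_eigenvalue; rewrite ?oner_neq0 //.
    exact: leq_trans (mxrankM_maxl _ _) rA.
  rewrite eigenvalue_root_char -cE -eigenvalue_root_char.
  exact: eigenvalue_idempotent.
rewrite -(mxtrace_char_poly cE) trE => /eqP.
by rewrite pnatr_eq1 => /eqP->.
Qed.

(** When the rank condition bears on phi2, the classification is applied with
    the roles of the two maps exchanged, and (d, U, V) becomes
    (d^-1, V^-1, U^-1). *)
Lemma standard_form_block : (1 < m)%N -> trace_condition phi1 phi2 ->
  rank_condition phi1 \/ rank_condition phi2 -> standard_form phi1 phi2.
Proof.
move=> m1 /trform_on_blocks psiP rk.
have [d [U [V [ud uU uV dUV]]]] : exists (d : 'M[R]_1) (U V : 'M[R]_m),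
  [/\ d \in unitmx, U \in unitmx, V \in unitmx &
      (forall w, psi1 w = (d *m w.1, U *m w.2 *m V) /\
         psi2 w = (w.1 *m invmx d, invmx V *m w.2 *m invmx U)) \/
      (forall w, psi1 w = (d *m w.1, U *m w.2^T *m V) /\
         psi2 w = (w.1 *m invmx d, invmx V *m w.2^T *m invmx U))].
  case: rk => rk.
    by apply: (classify_block psiP); rewrite ?m1 //; apply: on_blocks_rank.
  have psiP' x y : trform (psi2 x) (psi1 y) = trform x y.
    by rewrite trformC psiP trformC.
  have [|//|d [U [V [ud uU uV dUV]]]] := classify_block psiP'.
    exact: on_blocks_rank.
  exists (invmx d), (invmx V), (invmx U).
  rewrite !unitmx_inv !invmxK; split=> //.
  by case: dUV => h; [left|right] => w; have [-> ->] := h w;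
    rewrite ![_ *m w.1]mulmx11C.
right; split=> //; exists (of_blocks (d, U)), (of_blocks (1%:M, invmx V)).
split; rewrite ?unitmx_of_blocks ?unitmx_inv ?unitmx1 //;
  try exact: (of_blocks_span s_neq0 H_sym H_invol H_ones).
have QV : invmx (of_blocks (1%:M, invmx V)) = of_blocks (1%:M, V).
  by rewrite invmx_of_blocks ?unitmx_inv ?unitmx1 //= invmx1 invmxK.
case: dUV => h; [left|right] => A; have [h1 h2] := h (to_blocks (val A)).
  rewrite QV invmx_of_blocks // phi1E phi2E h1 h2.
  by split; rewrite -[in RHS]span_to_blocks !of_blocksM //= ?mulmx1 ?mul1mx.
rewrite QV invmx_of_blocks // phi1E phi2E h1 h2.
by split; rewrite -[in RHS]span_to_blocks tr_of_blocks // !of_blocksM //=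
  ?mulmx1 ?mul1mx.
Qed.

End Encoded.

Section Two.

Variables (R : realType) (H : 'M[R]_(1 + 1)) (s : R).
Hypothesis s_neq0 : s != 0.
Hypothesis H_sym : H^T = H.
Hypothesis H_invol : H *m H = 1%:M.
Hypothesis H_ones : H *m const_mx 1 = s *: (col_mx 1%:M 0 : 'cV_(1 + 1)).

(** For n = 2 the span consists of the matrices with rows (p, q) and (q, p), of
    eigenvalues w.1 = p + q and w.2 = p - q. *)
Lemma of_blocks2E w i j :
  of_blocks H w i j = (w.1 0 0 + (-1) ^+ (i + j) * w.2 0 0) / 2.
Proof.
have := of_blocks_ones s_neq0 H_invol H_ones w.
have := ones_of_blocks s_neq0 H_sym H_invol H_ones w.
have := mxtrace_of_blocks H_invol w; rewrite !trace_mx11.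
move: (of_blocks H w) (w.1 0 0) (w.2 0 0) => X c b.
rewrite /mxtrace !big_ord_recl big_ord0 addr0 => trX eX Xe.
have /colP/(_ ord0) := Xe; have /rowP/(_ ord0) := eX.
have /colP/(_ (lift ord0 ord0)) := Xe.
rewrite !mxE !big_ord_recl !big_ord0 !mxE !mulr1 !mul1r !addr0 => r1 c0 r0.
have ordE (k : 'I_2) : k = ord0 \/ k = lift ord0 ord0.
  by case: k => [[|[|//]] ?]; [left|right]; apply: val_inj.
case: (ordE i) => ->; case: (ordE j) => ->;
  rewrite /= ?addn0 ?expr0 ?expr1 ?sqrrN ?expr2; lra.
Qed.

(** Conjugation by diag(1, -1) changes the sign of the off-diagonal entries,
    which exchanges the two eigenvalues. *)
Lemma swap_of_blocks (w : 'M[R]_1 * 'M[R]_1) :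
  let S := diag_mx (\row_j (-1) ^+ j) in
  S *m of_blocks H w *m invmx S = of_blocks H (w.2, w.1).
Proof.
move=> S; have SS : S *m S = 1%:M := sign_diag_sqr R (1 + 1).
have [uS _] := mulmx1_unit SS.
have -> : invmx S = S by rewrite -[LHS]mulmx1 -SS mulKmx.
apply/matrixP => i j; rewrite mul_diag_mx mul_mx_diag [LHS]mxE.
rewrite [X in X * _]mxE !of_blocks2E !mxE /=.
rewrite exprD.
have := sqrr_sign R i; have := sqrr_sign R j.
rewrite !expr2; set a := (-1) ^+ i; set b := (-1) ^+ j => bb aa.
transitivity ((a * b * w.1 0 0 + (a * a) * (b * b) * w.2 0 0) / 2).
  by ring.
by rewrite aa bb !mul1r addrC.
Qed.

Lemma standard_form_two (phi1 phi2 : spanDS R (1 + 1) -> spanDS R (1 + 1)) :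
  trace_condition phi1 phi2 ->
  rank_condition phi1 \/ rank_condition phi2 -> standard_form phi1 phi2.
Proof.
move=> tr rk; left; split=> //.
have psiP := trform_on_blocks s_neq0 H_sym H_invol H_ones tr.
set psi1 := on_blocks _ _ _ _ phi1 in psiP.
set psi2 := on_blocks _ _ _ _ phi2 in psiP.
have phi1E A : val (phi1 A) = of_blocks H (psi1 (to_blocks H (val A))).
  exact: val_on_blocks.
have phi2E A : val (phi2 A) = of_blocks H (psi2 (to_blocks H (val A))).
  exact: val_on_blocks.
have span_to_blocks (A : spanDS R (1 + 1)) :
    of_blocks H (to_blocks H (val A)) = val A.
  by apply: to_blocksK s_neq0 H_sym H_invol H_ones _ _; apply: set_valP.
have [d [d' [ud ud' h]]] : exists d d' : 'M[R]_1,
  [/\ d \in unitmx, d' \in unitmx &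
    (forall w, psi1 w = (d *m w.1, d' *m w.2) /\
               psi2 w = (w.1 *m invmx d, w.2 *m invmx d')) \/
    (forall w, psi1 w = (d *m w.2, d' *m w.1) /\
               psi2 w = (w.2 *m invmx d, w.1 *m invmx d'))].
  case: rk => rk; first by apply: (classify_scalar psiP); apply: on_blocks_rank.
  have psiP' x y : trform (psi2 x) (psi1 y) = trform x y.
    by rewrite trformC psiP trformC.
  have [|d [d' [ud ud' h]]] := classify_scalar psiP'.
    exact: on_blocks_rank.
  exists (invmx d), (invmx d'); rewrite !unitmx_inv !invmxK; split=> //.
  by case: h => h; [left|right] => w; have [-> ->] := h w;
    rewrite ![_ *m w.1]mulmx11C ![_ *m w.2]mulmx11C.
case: h => h.
  exists (of_blocks H (d, d')), 1%:M.
  split=> [|||A|A]; rewrite ?unitmx_of_blocks //.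
  - exact: (of_blocks_span s_neq0 H_sym H_invol H_ones).
  - by left.
  - rewrite invmx1 !mulmx1 phi1E -[in RHS]span_to_blocks of_blocksM //=.
    by have [-> _] := h (to_blocks H (val A)).
  rewrite invmx1 !mulmx1 mul1mx phi2E -[in RHS]span_to_blocks.
  rewrite invmx_of_blocks // of_blocksM //=.
  by have [_ ->] := h (to_blocks H (val A)).
exists (of_blocks H (d, d')), (diag_mx (\row_j (-1) ^+ j)).
split=> [|||A|A]; rewrite ?unitmx_of_blocks //.
- exact: (of_blocks_span s_neq0 H_sym H_invol H_ones).
- by right.
- rewrite -2!mulmxA [X in _ *m X]mulmxA -[in RHS]span_to_blocks.
  rewrite swap_of_blocks phi1E of_blocksM //=.
  by have [-> _] := h (to_blocks H (val A)).
rewrite -[in RHS]span_to_blocks swap_of_blocks phi2E.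
rewrite invmx_of_blocks // of_blocksM //=.
by have [_ ->] := h (to_blocks H (val A)).
Qed.

End Two.

Lemma trace_standard_form (R : realType) (n : nat) (hn : (2 <= n)%N)
    (phi1 phi2 : spanDS R n -> spanDS R n) :
  trace_condition phi1 phi2 ->
  rank_condition phi1 \/ rank_condition phi2 -> standard_form phi1 phi2.
Proof.
case: n hn phi1 phi2 => [|[|[|m]]] // _ phi1 phi2 tr rk.
  have [|H [s [s0 Hs HH He]]] := @householder R 1; first by [].
  exact: (standard_form_two s0 Hs HH He).
have [|H [s [s0 Hs HH He]]] := @householder R m.+2; first by [].
exact: (standard_form_block s0 Hs HH He).
Qed.

Lemma spec_trace_rank (R : realType) (n : nat) (hn : (2 <= n)%N)
    (phi1 phi2 : spanDS R n -> spanDS R n) :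
  spec_condition phi1 phi2 -> trace_condition phi1 phi2 /\ rank_condition phi1.
Proof.
move=> sp; split; first exact: spec_trace.
case: n hn phi1 phi2 sp => [|[|m]] // _ phi1 phi2 sp.
have [|H [s [s0 Hs HH He]]] := @householder R m.+1; first by [].
exact: (spec_rank s0 Hs HH He sp).
Qed.

Theorem theorem3p5 (R : realType) (n : nat) (hn : (2 <= n)%N)
    (phi1 phi2 : spanDS R n -> spanDS R n) :
  [<-> (* (1) *)
       (forall A1 A2 : spanDS R n,
          \tr (val (phi1 A1) *m val (phi2 A2)) = \tr (val A1 *m val A2)) /\
       ((forall A : spanDS R n,
           (\rank (val A) <= 1)%N -> (\rank (val (phi1 A)) <= 1)%N) \/
        (forall A : spanDS R n,
           (\rank (val A) <= 1)%N -> (\rank (val (phi2 A)) <= 1)%N));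
       (* (2) *)
       forall A1 A2 : spanDS R n,
         spec (val (phi1 A1) *m val (phi2 A2)) = spec (val A1 *m val A2);
       (* (3): for n = 2, the diag_mx below is the matrix diag(1, -1) *)
       (n = 2%N /\
        exists C P : 'M[R]_n,
          [/\ C \in unitmx, spanDS R n C,
              P = 1%:M \/ P = diag_mx (\row_j (-1) ^+ j),
              forall A : spanDS R n,
                val (phi1 A) = C *m P *m val A *m invmx P
            & forall A : spanDS R n,
                val (phi2 A) = P *m val A *m invmx P *m invmx C]) \/
       ((3 <= n)%N /\
        exists P Q : 'M[R]_n,
          [/\ P \in unitmx, spanDS R n P, Q \in unitmx, spanDS R n Q &
              (forall A : spanDS R n,
                 val (phi1 A) = P *m val A *m invmx Q /\
                 val (phi2 A) = Q *m val A *m invmx P) \/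
              (forall A : spanDS R n,
                 val (phi1 A) = P *m (val A)^T *m invmx Q /\
                 val (phi2 A) = Q *m (val A)^T *m invmx P)])].
Proof.
tfae.
- by move=> [tr rk]; apply/standard_form_spec/trace_standard_form.
- move=> /(spec_trace_rank hn)[tr rk].
  by apply: trace_standard_form => //; left.
- move=> std; split; first exact/spec_trace/standard_form_spec.
  by left; apply: standard_form_rank std.
Qed.
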